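(* Let $a,b,p,q$ be real numbers and let $Q_{w,n}$ ($n\ge 0$) be the Horadam quaternions with parameters $(a,b;p,q)$. Then the generating function $g(t)=\sum_{n=0}^{\infty}Q_{w,n}t^n$ of the Horadam quaternions is $$g(t)=\frac{Q_{w,0}+(Q_{w,1}-pQ_{w,0})\,t}{1-pt-qt^2}.$$
   Context: The Horadam sequence $W_n=W_n(a,b;p,q)$ is defined by $W_0=a$, $W_1=b$ and $W_n=pW_{n-1}+qW_{n-2}$ for $n\ge 2$. The Horadam quaternions are $Q_{w,n}=W_n+W_{n+1}i+W_{n+2}j+W_{n+3}k$ for $n\ge 0$, where $i,j,k$ are the Hamilton units with $i^2=j^2=k^2=ijk=-1$. The identity is one of formal power series in a central indeterminate $t$ with quaternion coefficients; $1-pt-qt^2$ is an invertible power series with real coefficients. *)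

(* Defs.v *)
From HB Require Import structures.
From mathcomp Require Import all_boot all_order all_algebra ring.
From mathcomp Require Import boolp reals.

Set Implicit Arguments.
Unset Strict Implicit.
Unset Printing Implicit Defensive.

Import GRing.Theory.
Local Open Scope ring_scope.

(* Quat x y z w is x + y i + z j + w k. *)
Record quat (R : Type) : Type :=
  Quat { quat_re : R; quat_i : R; quat_j : R; quat_k : R }.

Definition tuple_of_quat (R : Type) (x : quat R) : R * R * R * R :=
  (quat_re x, quat_i x, quat_j x, quat_k x).

Definition quat_of_tuple (R : Type) (x : R * R * R * R) : quat R :=
  let: (a, b, c, d) := x in Quat a b c d.

Lemma tuple_of_quatK (R : Type) :
  cancel (@tuple_of_quat R) (@quat_of_tuple R).
Proof. by case. Qed.

HB.instance Definition _ (R : choiceType) :=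
  Choice.copy (quat R) (can_type (@tuple_of_quatK R)).

Definition quat_add (R : zmodType) (x y : quat R) : quat R :=
  let: Quat a b c d := x in let: Quat a' b' c' d' := y in
  Quat (a + a') (b + b') (c + c') (d + d').

Definition quat_opp (R : zmodType) (x : quat R) : quat R :=
  let: Quat a b c d := x in Quat (- a) (- b) (- c) (- d).

Lemma quat_addA (R : zmodType) : associative (@quat_add R).
Proof. by move=> [????] [????] [????] /=; rewrite !addrA. Qed.

Lemma quat_addC (R : zmodType) : commutative (@quat_add R).
Proof. by move=> [a b c d] [a' b' c' d'] /=; congr Quat; rewrite addrC. Qed.

Lemma quat_add0 (R : zmodType) : left_id (Quat 0 0 0 0) (@quat_add R).
Proof. by move=> [????] /=; rewrite !add0r. Qed.

Lemma quat_addN (R : zmodType) :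
  left_inverse (Quat 0 0 0 0) (@quat_opp R) (@quat_add R).
Proof. by move=> [????] /=; rewrite !addNr. Qed.

HB.instance Definition _ (R : zmodType) :=
  GRing.isZmodule.Build (quat R)
    (@quat_addA R) (@quat_addC R) (@quat_add0 R) (@quat_addN R).

Definition quat_mul (R : comNzRingType) (x y : quat R) : quat R :=
  let: Quat a b c d := x in let: Quat a' b' c' d' := y in
  Quat (a * a' - b * b' - c * c' - d * d')
       (a * b' + b * a' + c * d' - d * c')
       (a * c' - b * d' + c * a' + d * b')
       (a * d' + b * c' - c * b' + d * a').

Lemma quat_mulA (R : comNzRingType) : associative (@quat_mul R).
Proof. by move=> [????] [????] [????] /=; congr Quat; ring. Qed.

Lemma quat_mul1l (R : comNzRingType) : left_id (Quat 1 0 0 0) (@quat_mul R).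
Proof. by move=> [????] /=; congr Quat; ring. Qed.

Lemma quat_mul1r (R : comNzRingType) : right_id (Quat 1 0 0 0) (@quat_mul R).
Proof. by move=> [????] /=; congr Quat; ring. Qed.

Lemma quat_mulDl (R : comNzRingType) :
  left_distributive (@quat_mul R) (@quat_add R).
Proof. by move=> [????] [????] [????] /=; congr Quat; ring. Qed.

Lemma quat_mulDr (R : comNzRingType) :
  right_distributive (@quat_mul R) (@quat_add R).
Proof. by move=> [????] [????] [????] /=; congr Quat; ring. Qed.

Lemma quat_oner_neq0 (R : comNzRingType) : Quat 1 0 0 0 != 0 :> quat R.
Proof. by apply/eqP => -[] /eqP; rewrite oner_eq0. Qed.

HB.instance Definition _ (R : comNzRingType) :=
  GRing.Zmodule_isNzRing.Build (quat R)
    (@quat_mulA R) (@quat_mul1l R) (@quat_mul1r R)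
    (@quat_mulDl R) (@quat_mulDr R) (@quat_oner_neq0 R).

Definition quat_scale (R : comNzRingType) (r : R) (x : quat R) : quat R :=
  let: Quat a b c d := x in Quat (r * a) (r * b) (r * c) (r * d).

Lemma quat_scaleA (R : comNzRingType) (r s : R) (x : quat R) :
  quat_scale r (quat_scale s x) = quat_scale (r * s) x.
Proof. by case: x => [????] /=; rewrite !mulrA. Qed.

Lemma quat_scale1 (R : comNzRingType) : left_id 1 (@quat_scale R).
Proof. by case=> [????] /=; rewrite !mul1r. Qed.

Lemma quat_scaleDr (R : comNzRingType) :
  right_distributive (@quat_scale R) +%R.
Proof. by move=> r [????] [????]; congr Quat; rewrite mulrDr. Qed.

Lemma quat_scaleDl (R : comNzRingType) (x : quat R) :
  {morph (@quat_scale R)^~ x : r s / r + s}.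
Proof. by case: x => [????] r s; congr Quat; rewrite mulrDl. Qed.

HB.instance Definition _ (R : comNzRingType) :=
  GRing.Zmodule_isLmodule.Build R (quat R)
    (@quat_scaleA R) (@quat_scale1 R) (@quat_scaleDr R) (@quat_scaleDl R).

Definition real_quat (R : zmodType) (r : R) : quat R := Quat r 0 0 0.

Lemma quat_units (R : comNzRingType) (i := Quat 0 1 0 0 : quat R)
    (j := Quat 0 0 1 0 : quat R) (k := Quat 0 0 0 1 : quat R) :
  [/\ i * i = -1, j * j = -1, k * k = -1 & i * j * k = -1].
Proof. by split; congr Quat; ring. Qed.

Lemma quatE (R : comNzRingType) (a b c d : R) :
  Quat a b c d = real_quat a + b *: Quat 0 1 0 0 + c *: Quat 0 0 1 0
                 + d *: Quat 0 0 0 1.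
Proof. by congr Quat; ring. Qed.

(* A wrapper around nat -> A, which already carries pointwise structures. *)
Record fps (A : Type) : Type := Fps { fps_coef :> nat -> A }.

Notation "{ 'fps' A }" := (fps A) (at level 0, format "{ 'fps'  A }")
  : type_scope.

Lemma fpsP (A : Type) (f g : {fps A}) : f =1 g <-> f = g.
Proof.
by split=> [|->//]; case: f g => [f] [g] /= /funext ->.
Qed.

HB.instance Definition _ (A : Type) := gen_eqMixin {fps A}.
HB.instance Definition _ (A : Type) := gen_choiceMixin {fps A}.

Definition fps_add (A : zmodType) (f g : {fps A}) : {fps A} :=
  Fps (fun n => f n + g n).

Definition fps_opp (A : zmodType) (f : {fps A}) : {fps A} :=
  Fps (fun n => - f n).

Definition fps_zero (A : zmodType) : {fps A} := Fps (fun=> 0).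

Lemma fps_addA (A : zmodType) : associative (@fps_add A).
Proof. by move=> f g h; apply/fpsP => n /=; rewrite addrA. Qed.

Lemma fps_addC (A : zmodType) : commutative (@fps_add A).
Proof. by move=> f g; apply/fpsP => n /=; rewrite addrC. Qed.

Lemma fps_add0 (A : zmodType) : left_id (fps_zero A) (@fps_add A).
Proof. by move=> f; apply/fpsP => n /=; rewrite add0r. Qed.

Lemma fps_addN (A : zmodType) :
  left_inverse (fps_zero A) (@fps_opp A) (@fps_add A).
Proof. by move=> f; apply/fpsP => n /=; rewrite addNr. Qed.

HB.instance Definition _ (A : zmodType) :=
  GRing.isZmodule.Build {fps A}
    (@fps_addA A) (@fps_addC A) (@fps_add0 A) (@fps_addN A).

Definition fps_const (A : zmodType) (c : A) : {fps A} :=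
  Fps (fun n => if n == 0%N then c else 0).

Definition fps_mul (A : nzRingType) (f g : {fps A}) : {fps A} :=
  Fps (fun n => \sum_(i < n.+1) f i * g (n - i)%N).

Lemma fps_mul_poly (A : nzRingType) (f g : {fps A}) (m n : nat) : (n < m)%N ->
  fps_mul f g n = ((\poly_(i < m) f i) * (\poly_(i < m) g i))`_n.
Proof.
move=> lt_nm; rewrite coefM /=; apply: eq_bigr => i _; rewrite !coef_poly.
have -> : (i < m)%N by apply: leq_trans lt_nm; apply: ltn_ord.
by rewrite (leq_ltn_trans (leq_subr i n) lt_nm).
Qed.

Lemma fps_mulA (A : nzRingType) : associative (@fps_mul A).
Proof.
move=> f g h; apply/fpsP => n.
pose P (u : {fps A}) := \poly_(i < n.+1) u i.
transitivity ((P f * (P g * P h))`_n).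
  rewrite coefM /=; apply: eq_bigr => i _; rewrite coef_poly ltn_ord.
  by rewrite -(@fps_mul_poly _ g h n.+1) // ltnS leq_subr.
rewrite mulrA coefM /=; apply: eq_bigr => i _.
by rewrite coef_poly ltnS leq_subr -(@fps_mul_poly _ f g n.+1).
Qed.

Lemma fps_mul1l (A : nzRingType) : left_id (fps_const 1) (@fps_mul A).
Proof.
move=> f; apply/fpsP => n /=; rewrite big_ord_recl /= subn0 mul1r big1 ?addr0 //.
by move=> i _; rewrite mul0r.
Qed.

Lemma fps_mul1r (A : nzRingType) : right_id (fps_const 1) (@fps_mul A).
Proof.
move=> f; apply/fpsP => n /=; rewrite big_ord_recr /= subnn mulr1 big1 ?add0r //.
by move=> i _; rewrite subn_eq0 leqNgt ltn_ord mulr0.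
Qed.

Lemma fps_mulDl (A : nzRingType) : left_distributive (@fps_mul A) +%R.
Proof.
move=> f g h; apply/fpsP => n /=; rewrite -big_split /=.
by apply: eq_bigr => i _; rewrite mulrDl.
Qed.

Lemma fps_mulDr (A : nzRingType) : right_distributive (@fps_mul A) +%R.
Proof.
move=> f g h; apply/fpsP => n /=; rewrite -big_split /=.
by apply: eq_bigr => i _; rewrite mulrDr.
Qed.

Lemma fps_oner_neq0 (A : nzRingType) : fps_const 1 != 0 :> {fps A}.
Proof. by apply/eqP => /fpsP/(_ 0%N)/eqP; rewrite oner_eq0. Qed.

HB.instance Definition _ (A : nzRingType) :=
  GRing.Zmodule_isNzRing.Build {fps A}
    (@fps_mulA A) (@fps_mul1l A) (@fps_mul1r A)
    (@fps_mulDl A) (@fps_mulDr A) (@fps_oner_neq0 A).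

Lemma fps_mulC (A : comNzRingType) : commutative (@fps_mul A).
Proof.
move=> f g; apply/fpsP => n.
by rewrite !(@fps_mul_poly _ _ _ n.+1) // mulrC.
Qed.

HB.instance Definition _ (A : comNzRingType) :=
  GRing.PzRing_hasCommutativeMul.Build {fps A} (@fps_mulC A).

Definition fps_unit (A : comUnitRingType) : {pred {fps A}} :=
  fun f => f 0%N \is a GRing.unit.

(* The first n coefficients of the inverse of f. *)
Fixpoint fps_inv_seq (A : comUnitRingType) (f : {fps A}) (n : nat) : seq A :=
  if n is m.+1 then
    let s := fps_inv_seq f m in
    rcons s ((f 0%N)^-1 * ((m == 0%N)%:R - \sum_(i < m) s`_i * f (m - i)%N))
  else [::].

Definition fps_inv (A : comUnitRingType) (f : {fps A}) : {fps A} :=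
  if f 0%N \is a GRing.unit then Fps (fun n => (fps_inv_seq f n.+1)`_n) else f.

Lemma size_fps_inv_seq (A : comUnitRingType) (f : {fps A}) (n : nat) :
  size (fps_inv_seq f n) = n.
Proof. by elim: n => //= n IHn; rewrite size_rcons IHn. Qed.

Lemma nth_fps_inv_seq (A : comUnitRingType) (f : {fps A}) (i n : nat) :
  (i < n)%N -> (fps_inv_seq f n)`_i = (fps_inv_seq f i.+1)`_i.
Proof.
elim: n => // n IHn; rewrite ltnS leq_eqVlt => /predU1P[-> //|lt_in].
by rewrite -IHn //= nth_rcons size_fps_inv_seq lt_in.
Qed.

Lemma fps_mulVx (A : comUnitRingType) :
  {in @fps_unit A, left_inverse 1 (@fps_inv A) *%R}.
Proof.
move=> f; rewrite unfold_in => Uf; apply/fpsP => n.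
rewrite /fps_inv Uf /= big_ord_recr /= subnn.
rewrite nth_rcons size_fps_inv_seq ltnn eqxx.
set S := \sum_(i < n) (fps_inv_seq f n)`_i * _.
rewrite (_ : \sum_(i < n) _ = S); last first.
  by apply: eq_bigr => i _; rewrite -(nth_fps_inv_seq f (ltn_ord i)).
by rewrite -mulrA [_ * f 0%N]mulrC mulKr // addrC subrK; case: eqP.
Qed.

Lemma fps_unitPl (A : comUnitRingType) (f g : {fps A}) :
  g * f = 1 -> fps_unit f.
Proof.
move=> /fpsP/(_ 0%N); rewrite /= big_ord_recl big_ord0 addr0 => gf1.
by apply/unitrPr; exists (g 0%N); rewrite mulrC.
Qed.

Lemma fps_invr_out (A : comUnitRingType) :
  {in [predC @fps_unit A], @fps_inv A =1 id}.
Proof. by move=> f; rewrite inE unfold_in /fps_inv => /negPf ->. Qed.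

HB.instance Definition _ (A : comUnitRingType) :=
  GRing.ComNzRing_hasMulInverse.Build {fps A}
    (@fps_mulVx A) (@fps_unitPl A) (@fps_invr_out A).

Definition fps_X (A : nzRingType) : {fps A} := Fps (fun n => (n == 1%N)%:R).

Definition fps_map (A B : Type) (h : A -> B) (f : {fps A}) : {fps B} :=
  Fps (fun n => h (f n)).

Lemma fps_XC (A : nzRingType) (f : {fps A}) : GRing.comm f (fps_X A).
Proof.
apply/fpsP => n; rewrite !(@fps_mul_poly _ _ _ n.+2) //.
have -> : \poly_(i < n.+2) fps_X A i = 'X.
  apply/polyP => i; rewrite coef_poly coefX /=.
  by case: ltnP => //; case: eqP => // ->.
by rewrite commr_polyX.
Qed.

(* Division of a quaternion series by a real one is unambiguous: real series
   are central. *)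
Lemma fps_map_realC (R : comNzRingType) (f : {fps R}) (g : {fps quat R}) :
  GRing.comm (fps_map (@real_quat R) f) g.
Proof.
apply/fpsP => n /=; rewrite (reindex_inj rev_ord_inj) /=.
apply: eq_bigr => i _; rewrite subSS subKn; last by rewrite -ltnS.
by case: (g i) => [????]; congr Quat; ring.
Qed.

Definition fps_div_real (R : comUnitRingType) (f : {fps quat R}) (d : {fps R})
    : {fps quat R} :=
  f * fps_map (@real_quat R) d^-1.

Fixpoint horadam (R : nzRingType) (a b p q : R) (n : nat) : R :=
  match n with
  | 0 => a
  | 1 => b
  | (m.+1 as k).+1 => p * horadam a b p q k + q * horadam a b p q m
  end.

Definition horadam_quat (R : nzRingType) (a b p q : R) (n : nat) : quat R :=
  let W := horadam a b p q in Quat (W n) (W n.+1) (W n.+2) (W n.+3).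

Lemma horadam_den_unit (R : comUnitRingType) (p q : R) :
  1 - fps_const p * fps_X R - fps_const q * fps_X R ^+ 2 \is a GRing.unit.
Proof.
rewrite unfold_in /= /fps_unit expr2 /=.
by rewrite !(big_ord_recl, big_ord0) /= !(mulr0, addr0, subr0) unitr1.
Qed.

(* Main.v *)
Require Import Defs.
From mathcomp Require Import all_boot all_order all_algebra reals.
From mathcomp Require Import ring.
Import GRing.Theory.
Local Open Scope ring_scope.

(** Multiplying the series by [1 - p t - q t^2] kills every coefficient of
    degree at least 2, by the recurrence, and leaves the numerator. Real series
    embed multiplicatively in quaternion series, so one can then divide. *)

Lemma fps_coefMX (A : nzRingType) (f : {fps A}) (n : nat) :
  (f * fps_X A) n = if n is m.+1 then f m else 0.
Proof.
(* With [fps_X] on the left, the only surviving term of the convolution is the one at index 1, which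
   is peeled off from the front of the sum. *)
rewrite [f * _]fps_XC.
case: n => [|n] /=; first by rewrite big_ord1 mul0r.
rewrite !big_ord_recl /= mul0r add0r mul1r subSS subn0 big1 ?addr0 // => i _.
by rewrite mul0r.
Qed.

Lemma fps_coefCM (A : nzRingType) (c : A) (f : {fps A}) (n : nat) :
  (fps_const c * f) n = c * f n.
Proof.
by rewrite /= big_ord_recl /= subn0 big1 ?addr0 // => i _; rewrite mul0r.
Qed.

Lemma real_quatD (R : zmodType) : {morph @real_quat R : x y / x + y}.
Proof. by move=> x y; congr Quat; rewrite addr0. Qed.

Lemma real_quatM (R : comNzRingType) : {morph @real_quat R : x y / x * y}.
Proof. by move=> x y; congr Quat; ring. Qed.

Lemma quat_mul_real (R : comNzRingType) (x : quat R) (r : R) :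
  x * real_quat r = r *: x.
Proof. by case: x => [????]; congr Quat; ring. Qed.

Lemma fps_map_realM (R : comNzRingType) :
  {morph fps_map (@real_quat R) : f g / f * g}.
Proof.
move=> f g; apply/fpsP => n /=.
rewrite (big_morph _ (@real_quatD R) (erefl : real_quat 0 = 0)).
by apply: eq_bigr => i _; rewrite real_quatM.
Qed.

Lemma fps_map_real1 (R : comNzRingType) : fps_map (@real_quat R) 1 = 1.
Proof. by apply/fpsP => -[|n]. Qed.

(** The embedding of real series preserves products and 1, so the image of [d^-1] cancels that of
    [d]; inversion takes place only in the commutative ring [{fps R}]. *)
Lemma fps_div_realP (R : comUnitRingType) (f g : {fps quat R}) (d : {fps R}) :
  d \is a GRing.unit -> g * fps_map (@real_quat R) d = f -> g = fps_div_real f d.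
Proof.
move=> Ud <-.
by rewrite /fps_div_real -mulrA -fps_map_realM divrr // fps_map_real1 mulr1.
Qed.

Lemma horadam_den_coef (R : comNzRingType) (p q : R) (n : nat) :
  (1 - fps_const p * fps_X R - fps_const q * fps_X R ^+ 2) n
  = (n == 0)%:R - p * (n == 1)%:R - q * (n == 2)%:R.
Proof.
transitivity ((1 : {fps R}) n - (fps_const p * fps_X R) n
              - (fps_const q * fps_X R ^+ 2) n) => //.
rewrite !fps_coefCM expr2 fps_coefMX.
by case: n => [|[|[|n]]].
Qed.

(** In each of the four components this is the defining equation of [horadam], so both sides agree
    by computation. *)
Lemma horadam_quatSS (R : comNzRingType) (a b p q : R) (n : nat) :
  horadam_quat a b p q n.+2
  = p *: horadam_quat a b p q n.+1 + q *: horadam_quat a b p q n.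
Proof. by []. Qed.

Theorem theorem3p3 (R : realType) (a b p q : R) :
  let Q : nat -> quat R := horadam_quat a b p q in
  let g : {fps quat R} := Fps Q in
  let t : {fps quat R} := fps_X (quat R) in
  let tR : {fps R} := fps_X R in
  g = fps_div_real
        (fps_const (Q 0%N) + fps_const (Q 1%N - p *: Q 0%N) * t)
        (1 - fps_const p * tR - fps_const q * tR ^+ 2).
Proof.
move=> Q g t tR.
apply: fps_div_realP; first exact: horadam_den_unit.
apply/fpsP => n.
set d := 1 - _ - _.
(* Real coefficients act as scalars, so the convolution becomes a linear combination of the
   [Q i]. *)
transitivity (\sum_(i < n.+1) d (n - i)%N *: Q i).
  by apply: eq_bigr => i _; rewrite -quat_mul_real.
transitivity (fps_const (Q 0%N) n + (fps_const (Q 1%N - p *: Q 0%N) * t) n);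
  last by [].
rewrite fps_coefMX.
have d0 : d 0%N = 1 by rewrite horadam_den_coef !mulr0 !subr0.
have d1 : d 1%N = - p by rewrite horadam_den_coef mulr0 mulr1 sub0r subr0.
have d2 : d 2%N = - q by rewrite horadam_den_coef mulr0 mulr1 !sub0r oppr0 add0r.
have d3 k : d k.+3 = 0 by rewrite horadam_den_coef !mulr0 !subr0.
(* From here [d] is known only through its coefficients; degrees 0 and 1 yield the numerator. *)
clearbody d; case: n => [|[|n]].
- by rewrite big_ord1 /= d0 scale1r addr0.
- rewrite !big_ord_recr big_ord0 /= d0 d1 scale1r scaleNr !add0r.
  exact: addrC.
(* The indices [n], [n.+1], [n.+2] carry [d 2], [d 1], [d 0]. For [i < n] the degree [n.+2 - i]
   equals [(n - i.+1).+3], where [d] vanishes. *)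
rewrite 3!big_ord_recr big1 /=; last first.
  move=> i _; have lt_in := ltn_ord i.
  by rewrite !subSn ?leqW 1?ltnW // -subnSK // d3 scale0r.
have -> : (n.+2 - n = 2)%N by rewrite -addn2 addKn.
rewrite subnn subSnn d0 d1 d2 /Q horadam_quatSS.
rewrite scale1r !scaleNr !add0r.
by rewrite -opprD [p *: _ + _]addrC addNr.
Qed.
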